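(* Let $(S,\mathcal S,\lambda)$ be the unit interval with its Borel $\sigma$-algebra and Lebesgue measure. Suppose $\{\varrho_n\}_{n\ge0}$ is a complete orthogonal system in $L_2(S,\mathcal S,\lambda)$ such that $\varrho_0\equiv1$ and, for each $n\ge1$, $\varrho_n$ takes values in $\{-1,1\}$ and $\int_S\varrho_n\,d\lambda=0$. Let $\rho_0=\varrho_0$ and $\rho_n=\varrho_n+1$ for $n\ge1$. Let $G(s)=\{-1,1\}$ for all $s\in S$, and let $f\equiv0$, which is a measurable selection of $\mathrm{co}(G)$ (where $\mathrm{co}(G)(s)=[-1,1]$). Then for any sub-$\sigma$-algebra $\mathcal F\subseteq\mathcal S$, there is no $\mathcal S$-measurable selection $g$ of $G$ such that $\mathbb E^\lambda(g\rho_n|\mathcal F)=\mathbb E^\lambda(f\rho_n|\mathcal F)$ for every $n\ge0$.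
   Context: An $\mathcal S$-measurable selection of $G$ is an $\mathcal S$-measurable function $g:S\to\mathbb R$ with $g(s)\in G(s)$ for all $s$. $\mathbb E^\lambda(\cdot|\mathcal F)$ denotes conditional expectation with respect to $\lambda$; equalities of conditional expectations are $\lambda$-almost sure. A complete orthogonal system in $L_2$ is an orthogonal family of nonzero elements such that the only element of $L_2$ orthogonal to all of them is $0$. *)

(* Defs.v *)
(* MathComp-Analysis. *)
From HB Require Import structures.
From mathcomp Require Import all_boot all_order all_algebra.
From mathcomp Require Import all_classical all_reals all_analysis.
From mathcomp Require Import measurable_realfun.

Set Implicit Arguments.
Unset Strict Implicit.
Unset Printing Implicit Defensive.

Import Order.TTheory GRing.Theory Num.Theory.
Import numFieldNormedType.Exports.

Local Open Scope classical_set_scope.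
Local Open Scope ring_scope.

Definition unit_interval (R : realType) : Type :=
  {x : R | x \in `[0, 1]%classic}.

Section unit_interval_space.
Context (R : realType).

HB.instance Definition _ := Choice.on (unit_interval R).

Fact unit_interval0 : (0 : R) \in `[0, 1]%classic.
Proof. by rewrite inE /= in_itv /= lexx ler01. Qed.

HB.instance Definition _ :=
  isPointed.Build (unit_interval R) (exist _ 0 unit_interval0).

Definition unit_val : unit_interval R -> measurableTypeR R := sval.

(* The Borel sigma-algebra of [0, 1] is the trace of that of R: its members are
   the sets unit_val @^-1` B with B Borel. *)
Definition unitI : Type := g_sigma_algebra_preimageType unit_val.

HB.instance Definition _ := Measurable.on unitI.

Lemma unit_val_inj : injective unit_val.
Proof. exact: val_inj. Qed.

Lemma unit_val_image_preimage (B : set R) :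
  unit_val @` (unit_val @^-1` B) = B `&` `[0, 1]%classic.
Proof.
apply/seteqP; split => [_ [[x /= x01] Bx <-]|x [Bx x01]] /=.
  by split=> //; move: x01; rewrite inE.
by exists (exist _ x (mem_set x01)).
Qed.

Lemma measurable_unit_image (A : set unitI) :
  measurable A -> measurable (unit_val @` A).
Proof.
case=> B mB <-; rewrite setTI unit_val_image_preimage.
by apply: measurableI => //; exact: measurable_itv.
Qed.

Lemma measurable_unit_val : measurable_fun [set: unitI] unit_val.
Proof. by move=> _ B mB; exists B. Qed.

Definition unit_lebesgue (A : set unitI) : \bar R :=
  lebesgue_measure (unit_val @` A).

Let unit_lebesgue0 : unit_lebesgue set0 = 0%E.
Proof. by rewrite /unit_lebesgue image_set0 measure0. Qed.

Let unit_lebesgue_ge0 A : (0 <= unit_lebesgue A)%E.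
Proof. exact: measure_ge0. Qed.

Let unit_lebesgue_sigma_additive : semi_sigma_additive unit_lebesgue.
Proof.
move=> A mA tA mUA; rewrite /unit_lebesgue image_bigcup.
apply: measure_semi_sigma_additive.
- by move=> n; exact: measurable_unit_image.
- move=> i j _ _ [_ [[x Ax <-] [y Ay /unit_val_inj yx]]].
  by apply: tA => //; exists x; split => //; rewrite -yx.
- by apply: bigcup_measurable => n _; exact: measurable_unit_image.
Qed.

HB.instance Definition _ := isMeasure.Build _ _ _ unit_lebesgue
  unit_lebesgue0 unit_lebesgue_ge0 unit_lebesgue_sigma_additive.

Let unit_lebesgue_setT : unit_lebesgue setT = 1%E.
Proof.
rewrite /unit_lebesgue -(preimage_setT unit_val) unit_val_image_preimage setTI.
by rewrite lebesgue_measure_itv /= lte_fin ltr01 oppr0 adde0.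
Qed.

HB.instance Definition _ :=
  Measure_isProbability.Build _ _ _ unit_lebesgue unit_lebesgue_setT.

End unit_interval_space.

Arguments unit_val : clear implicits.
Arguments unit_lebesgue R A : clear implicits.

Section conditional_expectation.
Context (d : measure_display) (T : measurableType d) (R : realType).

Definition sigma_subalgebra (F : set (set T)) : Prop :=
  sigma_algebra [set: T] F /\ F `<=` measurable.

Definition is_condexp (mu : {measure set T -> \bar R}) (F : set (set T))
    (h e : T -> R) : Prop :=
  [/\ forall B : set R, measurable B -> F (e @^-1` B),
      mu.-integrable [set: T] (EFin \o e) &
      forall A, F A -> (\int[mu]_(x in A) (e x)%:E = \int[mu]_(x in A) (h x)%:E)%E].

(* A version of E^mu(h | F); the value 0 is only used when there is none, which
   condexpP excludes for integrable h. *)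
Definition condexp (mu : {measure set T -> \bar R}) (F : set (set T))
    (h : T -> R) : T -> R :=
  xget (cst 0) [set e | is_condexp mu F h e].

End conditional_expectation.

Section condexp_exists.
Local Open Scope ereal_scope.
Context (d : measure_display) (T : measurableType d) (R : realType).
Variables (mu : {finite_measure set T -> \bar R}) (F : set (set T)) (h : T -> R).
Hypotheses (sF : sigma_subalgebra F) (ih : mu.-integrable [set: T] (EFin \o h)).

Local Notation TF := (g_sigma_algebraType F).

Let FE (A : set TF) : measurable A = F A.
Proof. by rewrite /measurable /= sigma_algebra_id //; exact: sF.1. Qed.

(* A version of E^mu(h | F) is the Radon-Nikodym derivative of the charge
   A |-> \int_A h on F with respect to the restriction of mu to F. *)
Definition condexp_measure (A : set TF) : \bar R := mu (A : set T).
Definition condexp_charge (A : set TF) : \bar R := \int[mu]_(x in (A : set T)) (h x)%:E.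

Let mF (A : set TF) : measurable A -> measurable (A : set T).
Proof. by rewrite FE; exact: sF.2. Qed.

Let muF0 : condexp_measure set0 = 0. Proof. exact: measure0. Qed.
Let muF_ge0 A : 0 <= condexp_measure A. Proof. exact: measure_ge0. Qed.
Let muF_sigma : semi_sigma_additive condexp_measure.
Proof.
move=> A mA tA mUA.
by apply: (@measure_semi_sigma_additive _ _ _ mu) => // [n|]; exact: mF.
Qed.
HB.instance Definition _ := isMeasure.Build _ _ _ condexp_measure muF0 muF_ge0 muF_sigma.

Let muF_fin : fin_num_fun condexp_measure.
Proof. by move=> A /mF mA; exact: fin_num_measure. Qed.
HB.instance Definition _ := Measure_isFinite.Build _ _ _ condexp_measure muF_fin.

Let nuF0 : condexp_charge set0 = 0. Proof. exact: integral_set0. Qed.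
Let nuF_fin A : measurable A -> condexp_charge A \is a fin_num.
Proof.
by move=> /mF mA; apply: integrable_fin_num => //; exact: integrableS ih.
Qed.
Let nuF_sigma : semi_sigma_additive condexp_charge.
Proof.
move=> A mA tA mUA.
by apply: (@charge_semi_sigma_additive _ _ _ (induced_charge ih)) => // [n|]; exact: mF.
Qed.
HB.instance Definition _ := isCharge.Build _ _ _ condexp_charge nuF0 nuF_fin nuF_sigma.

Lemma condexpP : is_condexp mu F h (condexp mu F h).
Proof.
rewrite /condexp; suff [e he] : exists e, is_condexp mu F h e by apply: xgetI he.
have numu : condexp_charge `<< condexp_measure.
  apply/null_content_dominatesP => A mA muA.
  apply: (@null_set_integral _ _ _ mu) => //; first exact: mF.
  by apply: measurable_funTS; exact: measurable_int ih.
have [f [ffin fint fE]] : exists f : TF -> \bar R,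
    [/\ forall x, f x \is a fin_num, condexp_measure.-integrable [set: TF] f &
    forall A, measurable A -> condexp_charge A = \int[condexp_measure]_(x in A) f x].
  exists (Radon_Nikodym condexp_charge condexp_measure); split.
  - by move=> x; exact: Radon_Nikodym_fin_num.
  - exact: Radon_Nikodym_integrable.
  - by move=> A mA; exact: Radon_Nikodym_integral.
pose idF : T -> TF := idfun.
have midF : measurable_fun [set: T] idF by move=> _ B /mF mB; rewrite setTI.
have mf : measurable_fun [set: TF] f by exact: measurable_int fint.
have fintT : mu.-integrable [set: T] (f \o idF).
  apply/integrableP; split; first exact: measurableT_comp.
  have /integrableP[_] := fint.
  suff -> : \int[condexp_measure]_x `|f x| = \int[mu]_x `|(f \o idF) x| by [].
  apply: (@ge0_integral_pushforward _ _ _ _ _ idF midF mu setT (abse \o f)) => //.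
    exact: measurableT_comp.
  by move=> y _; exact: abse_ge0.
exists (fine \o f : T -> R).
have fe : EFin \o (fine \o f) = f by apply/funext => x /=; rewrite fineK.
split.
- move=> B mB; rewrite -FE -[X in measurable X]setTI.
  have : measurable_fun [set: TF] (fine \o f) by exact: measurableT_comp.
  by apply.
- by rewrite fe.
- move=> A FA; have mA : measurable (A : set TF) by rewrite FE.
  transitivity (condexp_charge A); last by [].
  rewrite fE //.
  rewrite -[RHS]/(\int[condexp_measure]_(x in A) f x).
  transitivity (\int[mu]_(x in A) (f \o idF) x).
    by apply: eq_integral => x _; rewrite /= fineK.
  apply/esym/(@integral_pushforward _ _ _ _ _ idF midF mu A f) => //.
  by apply: integrableS fintT => //; exact: mF.
Qed.
End condexp_exists.

Section L2.
Context (d : measure_display) (T : measurableType d) (R : realType).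
Variable mu : {measure set T -> \bar R}.

Definition L2inner (f g : T -> R) : R := \int[mu]_x (f x * g x).

(* Elements of L_2 are represented by square-integrable functions, with
   equality mu-almost everywhere. *)
Definition complete_orthogonal_system (e : nat -> T -> R) : Prop :=
  [/\ forall n, e n \in Lfun mu 2%:E,
      forall n, ~ ae_eq mu [set: T] (e n) (cst 0),
      forall m n, m != n -> L2inner (e m) (e n) = 0 &
      forall h, h \in Lfun mu 2%:E -> (forall n, L2inner h (e n) = 0) ->
        ae_eq mu [set: T] h (cst 0)].

End L2.

Section selections.
Context (d : measure_display) (T : measurableType d) (R : realType).

Definition measurable_selection (G : T -> set R) (g : T -> R) : Prop :=
  measurable_fun [set: T] g /\ forall s, G s (g s).

Definition convex_hull (A : set R) : set R :=
  smallest (@convex_set R R^o) A.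

Definition co (G : T -> set R) : T -> set R := fun s => convex_hull (G s).

End selections.

(* Main.v *)
(** Taking [A = S] in the definition of conditional expectation shows that the
    condition forces [g * rho_n] to have integral 0 for every [n], whatever [F]
    is. The case [n = 0] gives that [g] has integral 0, and then the case
    [n >= 1] gives [g] orthogonal to [varrho_n]. So completeness makes [g]
    vanish a.e., which is impossible for a function with values in [{-1, 1}]. *)
Require Import Defs.
From HB Require Import structures.
From mathcomp Require Import all_boot all_order all_algebra.
From mathcomp Require Import all_classical all_reals all_analysis.
From mathcomp Require Import ring.

Import Order.TTheory GRing.Theory Num.Theory.
Import numFieldNormedType.Exports.

Local Open Scope classical_set_scope.
Local Open Scope ring_scope.

Lemma convex_set_itvcc (R : realFieldType) (a b : R) :
  @convex_set R R^o `[a, b]%classic.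
Proof.
move=> x y t; rewrite !inE /= !in_itv /= => /andP[ax xb] /andP[ay yb].
(* Unfolds the convex combination of [R^o] into ordinary arithmetic; the weight [t] goes to the
   first point. *)
change (a <= t%:num * x + (1 - t%:num) * y <= b).
have t0 : 0 <= t%:num by exact: ge0.
have t1 : 0 <= (1 - t%:num) by rewrite subr_ge0; exact: le1.
apply/andP; split.
  have -> : a = t%:num * a + (1 - t%:num) * a by ring.
  by apply: lerD; apply: ler_wpM2l.
have -> : b = t%:num * b + (1 - t%:num) * b by ring.
by apply: lerD; apply: ler_wpM2l.
Qed.

(** The interval is itself convex and contains both points. Conversely, solving
    [t * a + (1 - t) * b = x] gives [t = (b - x) / (b - a)], which lies in [[0, 1]]. *)
Lemma convex_hull_pair (R : realType) (a b : R) : a < b ->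
  convex_hull [set a; b] = `[a, b]%classic.
Proof.
move=> ab; apply/seteqP; split.
  apply: smallest_sub; first exact: convex_set_itvcc.
  by move=> x [->|->] /=; rewrite in_itv /= lexx ltW.
move=> x /=; rewrite in_itv /= => /andP[ax xb] M [cM abM].
have ba0 : 0 < b - a by rewrite subr_gt0.
have t0 : 0 <= (b - x) / (b - a) by rewrite divr_ge0 ?subr_ge0 // ltW.
have t1 : (b - x) / (b - a) <= 1 by rewrite ler_pdivrMr // mul1r lerB.
have aM : a \in M by apply/mem_set/abM; left.
have bM : b \in M by apply/mem_set/abM; right.
have := cM a b (Itv01 t0 t1) aM bM.
rewrite inE; congr M.
change ((b - x) / (b - a) * a + (1 - (b - x) / (b - a)) * b = x).
by field; rewrite gt_eqF.
Qed.

Section sign_valued.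
Context {d : measure_display} {T : measurableType d} {R : realType}.
Implicit Types (h : T -> R).

(** The norm depends only on the absolute value, so [h] has the norm of the constant 1, which is
    finite for a finite measure. *)
Lemma sign_valued_Lfun (mu : {finite_measure set T -> \bar R}) h (r : R) :
  measurable_fun [set: T] h -> (forall x, [set -1; 1] (h x)) ->
  h \in Lfun mu r%:E.
Proof.
move=> mh h1; have /andP[_] := Lfun_cst mu 1 r.
rewrite !inE => c1; apply/andP; split; rewrite inE //=.
suff : ('N[mu]_r%:E[EFin \o h] = 'N[mu]_r%:E[EFin \o cst 1%R])%E.
  by rewrite /finite_norm => ->.
rewrite -[LHS]Lnorm_abse -[RHS]Lnorm_abse; congr Lnorm; apply/funext => x /=.
by case: (h1 x) => ->; rewrite ?normrN1 ?normr1.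
Qed.

(** Since [h] vanishes nowhere, the exceptional set would be the whole space, of measure 1. *)
Lemma sign_valued_not_ae0 (mu : probability T R) h :
  (forall x, [set -1; 1] (h x)) -> ~ ae_eq mu [set: T] h (cst 0).
Proof.
move=> h1 h0.
have : mu.-negligible [set: T].
  apply: negligibleS h0 => x _ /= /(_ I) hx0.
  by case: (h1 x) => /eqP; rewrite hx0 eq_sym ?oppr_eq0 oner_eq0.
move/(negligibleP _ measurableT) => mu0.
by have := probability_setT mu; rewrite [LHS]mu0 => /esym/eqP; rewrite onee_eq0.
Qed.

End sign_valued.

Section ae_eq_condexp.
Context {d : measure_display} {T : measurableType d} {R : realType}.
Variables (mu : {finite_measure set T -> \bar R}) (F : set (set T)).

(** The whole space belongs to [F], and over it a conditional expectation has the same integral as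
    the function. Integrability ensures that [condexp] is a true version, not the default value. *)
Lemma ae_eq_condexp_integral (h k : T -> R) : sigma_subalgebra F ->
  mu.-integrable [set: T] (EFin \o h) -> mu.-integrable [set: T] (EFin \o k) ->
  ae_eq mu [set: T] (condexp mu F h) (condexp mu F k) ->
  \int[mu]_x h x = \int[mu]_x k x.
Proof.
move=> sF ih ik hk.
have FT : F [set: T].
  by have [F0 FC _] := sF.1; rewrite -(setD0 setT); exact: FC.
have [_ ieh Eh] := condexpP sF ih; have [_ iek Ek] := condexpP sF ik.
rewrite /Rintegral -(Eh _ FT) -(Ek _ FT); congr fine.
apply: ae_eq_integral => //.
- exact: measurable_int ieh.
- exact: measurable_int iek.
- by apply: filterS hk => x hkx /hkx /= ->.
Qed.

End ae_eq_condexp.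

Theorem proposition5 (R : realType)
  (varrho rho : nat -> unitI R -> R) (G : unitI R -> set R) (f : unitI R -> R)
  (h_cos : complete_orthogonal_system (unit_lebesgue R) varrho)
  (h_varrho0 : forall s, varrho 0%N s = 1)
  (h_varrho_val : forall n s, (1 <= n)%N -> [set -1; 1] (varrho n s))
  (h_varrho_int : forall n, (1 <= n)%N ->
     \int[unit_lebesgue R]_s varrho n s = 0)
  (h_rho0 : rho 0%N = varrho 0%N)
  (h_rho : forall n s, (1 <= n)%N -> rho n s = varrho n s + 1)
  (h_G : forall s, G s = [set -1; 1])
  (h_f : forall s, f s = 0) :
  (forall s, co G s = `[-1, 1]%classic) /\
  measurable_selection (co G) f /\
  forall F : set (set (unitI R)), sigma_subalgebra F ->
    ~ exists g : unitI R -> R,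
        measurable_selection G g /\
        forall n, ae_eq (unit_lebesgue R) [set: unitI R]
          (condexp (unit_lebesgue R) F (fun s => g s * rho n s))
          (condexp (unit_lebesgue R) F (fun s => f s * rho n s)).
Proof.
have coE s : co G s = `[-1, 1]%classic.
  by rewrite /co h_G convex_hull_pair // gtrN.
split => //; split.
  split; first by rewrite (_ : f = cst 0) //; apply/funext.
  by move=> s; rewrite coE h_f /= in_itv /= oppr_le0 ler01.
move=> F sF [g [[mg Gg] eqE]].
have g1 s : [set -1; 1] (g s) by rewrite -(h_G s).
have [varrho_L2 _ _ complete] := h_cos.
have gL2 : g \in Lfun (unit_lebesgue R) 2%:E by exact: sign_valued_Lfun.
have ig : (unit_lebesgue R).-integrable setT (EFin \o g).
  by apply/Lfun1_integrable/Lfun_subset12 => //; exact: fin_num_measure.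
(* A product of two square-integrable functions is integrable. *)
have igv n : (unit_lebesgue R).-integrable setT (EFin \o (g \* varrho n)).
  by apply/Lfun1_integrable/Lfun2_mul_Lfun1.
(* Integrability stays a premise because it is obtained differently for [n = 0] and for [n >= 1]. *)
have rho_int n : (unit_lebesgue R).-integrable setT (EFin \o (g \* rho n)) ->
    \int[unit_lebesgue R]_s (g s * rho n s) = 0.
  move=> igr.
  have -> : 0 = \int[unit_lebesgue R]_s (f s * rho n s).
    rewrite -(mul0r (fine (unit_lebesgue R setT))) -Rintegral_cst //.
    by apply: eq_Rintegral => s _; rewrite h_f mul0r.
  apply: ae_eq_condexp_integral (eqE n) => //.
  rewrite (_ : _ \o _ = cst 0%E); first exact: integrable0.
  by apply/funext => s /=; rewrite h_f mul0r.
have g0 : \int[unit_lebesgue R]_s g s = 0.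
  rewrite -(rho_int 0%N); last by rewrite h_rho0; exact: igv.
  by apply: eq_Rintegral => s _; rewrite h_rho0 h_varrho0 mulr1.
(* What remains is the orthogonality of [g] to each [varrho n]; for index 0 this is [g0]. *)
apply: (sign_valued_not_ae0 (unit_lebesgue R) g g1); apply: complete => // -[|n].
  by rewrite -[RHS]g0; apply: eq_Rintegral => s _; rewrite h_varrho0 mulr1.
(* The shift by 1 in [rho] adds only the integral of [g], already known to be 0. *)
have rhoE : (fun s => g s * rho n.+1 s) = (fun s => (g \* varrho n.+1) s + g s).
  by apply/funext => s; rewrite h_rho // mulrDr mulr1.
have := rho_int n.+1.
rewrite [X in EFin \o X](_ : _ = (g \* varrho n.+1) \+ g); last exact: rhoE.
rewrite rhoE RintegralD // g0 addr0; apply.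
have := integrableD measurableT (igv n.+1) ig.
exact: eq_integrable.
Qed.
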